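(* Let $A$ and $B$ be unital $C^*$-algebras and let $\phi : A \to B$ be a unital $*$-preserving ring homomorphism (not assumed to be linear). Then $\phi$ is contractive; i.e., $\|\phi(a)\| \leq \|a\|$ for all $a \in A$. Consequently, $\phi$ is also continuous.
   Context: All $C^*$-algebras are over $\mathbb{C}$. A ring homomorphism $\phi : A \to B$ between $C^*$-algebras is a function that is additive ($\phi(a+b)=\phi(a)+\phi(b)$ for all $a,b\in A$) and multiplicative ($\phi(ab)=\phi(a)\phi(b)$ for all $a,b \in A$); it is not assumed to be compatible with scalar multiplication. It is $*$-preserving if $\phi(a^* )=\phi(a)^*$ for all $a \in A$. When $A$ and $B$ have units $1_A$ and $1_B$, it is unital if $\phi(1_A)=1_B$. *)

(* Defs.v *)
From HB Require Import structures.
From mathcomp Require Import all_boot all_order all_algebra.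
From mathcomp Require Import all_classical all_reals all_analysis.
From mathcomp Require Export complex.

Set Implicit Arguments.
Unset Strict Implicit.
Unset Printing Implicit Defensive.

Import Order.TTheory GRing.Theory Num.Theory.
Local Open Scope ring_scope.

(* Hierarchy Builder refuses a direct join of [GRing.PzRing] with a normed
   module structure, because [Num.NumDomain] already inherits from a ring and a
   norm without going through such a join.  Hence the product and the unit are
   fields of the mixin, and the ring structure is attached to
   [unitalCstarAlgType R] as an instance just below.
   There is no axiom 1 != 0: the zero algebra is a unital C*-algebra.
   The norm of a [completeNormedModType R[i]] takes its values in R[i]; these
   are nonnegative, hence real, and there the order of R[i] is that of R. *)
HB.mixin Record isUnitalCstarAlgebra (R : realType) A
    & CompleteNormedModule R[i] A := {
  cs_one : A ;
  cs_mul : A -> A -> A ;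
  star : A -> A ;
  cs_mulA : associative cs_mul ;
  cs_mul1l : left_id cs_one cs_mul ;
  cs_mul1r : right_id cs_one cs_mul ;
  cs_mulDl : left_distributive cs_mul +%R ;
  cs_mulDr : right_distributive cs_mul +%R ;
  cs_scaleAl : forall (k : R[i]) (x y : A),
    k *: cs_mul x y = cs_mul (k *: x) y ;
  cs_scaleAr : forall (k : R[i]) (x y : A),
    k *: cs_mul x y = cs_mul x (k *: y) ;
  cs_normM : forall x y : A, `|cs_mul x y| <= `|x| * `|y| ;
  starK : involutive star ;
  starD : {morph star : x y / x + y} ;
  starZ : forall (k : R[i]) (x : A), star (k *: x) = k^* *: star x ;
  cs_starM : forall x y : A, star (cs_mul x y) = cs_mul (star y) (star x) ;
  cs_normE : forall x : A, `|cs_mul (star x) x| = `|x| ^+ 2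
}.

#[short(type="unitalCstarAlgType")]
HB.structure Definition UnitalCstarAlgebra (R : realType) :=
  {A of CompleteNormedModule R[i] A & isUnitalCstarAlgebra R A}.

#[non_forgetful_inheritance]
HB.instance Definition _ (R : realType) (A : unitalCstarAlgType R) :=
  GRing.Zmodule_isPzRing.Build A
    cs_mulA cs_mul1l cs_mul1r cs_mulDl cs_mulDr.

Section CstarTheory.
Variables (R : realType) (A : unitalCstarAlgType R).
Implicit Types (k : R[i]) (x y : A).

Lemma cstar_scalerAl k x y : k *: (x * y) = (k *: x) * y.
Proof. exact: cs_scaleAl. Qed.

Lemma cstar_scalerAr k x y : k *: (x * y) = x * (k *: y).
Proof. exact: cs_scaleAr. Qed.

Lemma cstar_normrM x y : `|x * y| <= `|x| * `|y|.
Proof. exact: cs_normM. Qed.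

Lemma starM x y : star (x * y) = star y * star x.
Proof. exact: cs_starM. Qed.

Lemma cstar_normE x : `|star x * x| = `|x| ^+ 2.
Proof. exact: cs_normE. Qed.

End CstarTheory.

(* Main.v *)
(* [phi] is only Q-linear, so no spectral theory is transported along it.
   Let [h] be self-adjoint with [`|h| < N].  Then [h / N] has a self-adjoint
   partner [k], commuting with it, such that [(h / N)^2 + k^2 = 1]; these
   relations survive under [phi], so [phi (h / N) + i phi k] is unitary in [B]
   and its real part [phi (h / N)] has norm at most 1.  Hence
   [`|phi h| <= N], and applying this to the multiples of [h] gives
   [`|phi h| <= `|h|].  The general case is the C*-identity.
   The partner is [k = 1 - t], with [t] the fixed point of
   [t |-> ((h / N)^2 + t^2) / 2] in the ball of radius [`|h / N|]. *)
Require Import Defs.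
From mathcomp Require Import all_boot all_order all_algebra.
From mathcomp Require Import all_classical all_reals all_analysis.

Import Order.TTheory GRing.Theory Num.Theory.
Import numFieldNormedType.Exports.

Local Open Scope ring_scope.

(** In the partial order of [R[i]], [0 <= z] forces [z] to be real, so truncating its real part
    suffices. *)
Lemma complex_truncn {R : realType} (z : R[i]) :
  0 <= z -> exists n : nat, n%:R <= z < n.+1%:R.
Proof.
move=> z0.
have zE : (complex.Re z)%:C%C = z by rewrite complex.RRe_real ?ger0_real.
have x0 : 0 <= complex.Re z.
  by move: z0; rewrite -{1}zE -(rmorph0 (real_complex R)) complex.lecR.
exists (Num.truncn (complex.Re z)).
rewrite -zE -!(rmorph_nat (real_complex R)) complex.lecR complex.ltcR /=.
exact: truncn_itv.
Qed.

Lemma complex_expr_lt {R : realType} (c e : R[i]) :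
  0 <= c -> c < 1 -> 0 < e -> exists n : nat, c ^+ n < e.
Proof.
move=> c0 c1 e0.
have cE : (complex.Re c)%:C%C = c by rewrite complex.RRe_real ?ger0_real.
have eE : (complex.Re e)%:C%C = e by rewrite complex.RRe_real ?gtr0_real.
move: c0 c1 e0; rewrite -cE -eE -(rmorph0 (real_complex R)).
rewrite -(rmorph1 (real_complex R)) complex.lecR !complex.ltcR => c0 c1 e0.
have /cvgrPdist_lt/(_ _ e0) :
    (complex.Re c ^+ n @[n --> \oo] --> (0 : R))%classic.
  by apply: cvg_expr; rewrite ger0_norm.
case=> N _ /(_ N (leqnn N)) /=.
rewrite sub0r normrN ger0_norm ?exprn_ge0// => h.
by exists N; rewrite -rmorphXn complex.ltcR.
Qed.

(** Picard iteration from 0: the iterates stay in the ball, where [F] contracts, and completeness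
    provides the limit. *)
Lemma ball_fixed_point {R : realType} (V : completeNormedModType R[i])
    (F : V -> V) (r c : R[i]) :
    0 <= r -> 0 <= c -> c < 1 ->
    (forall x, `|x| <= r -> `|F x| <= r) ->
    (forall x y, `|x| <= r -> `|y| <= r -> `|F x - F y| <= c * `|x - y|) ->
  exists2 x, `|x| <= r & F x = x.
Proof.
move=> r0 c0 c1 Fr Fc; pose u n := iter n F 0.
have ur n : `|u n| <= r.
  by elim: n => [|n IH] /=; rewrite ?normr0//; exact: Fr.
(* Induction on [n] removes one [F] from both iterates; the base case is [u m] lying in the ball, so
   no geometric series appears. *)
have uc n m : `|u (n + m)%N - u n| <= c ^+ n * r.
  elim: n => [|n IH]; first by rewrite add0n subr0 mul1r.
  rewrite addSn exprS -mulrA; apply: le_trans (Fc _ _ (ur _) (ur _)) _.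
  exact: ler_wpM2l.
have small e : 0 < e -> exists n, c ^+ n * r < e.
  (* The radius may be 0, hence the division by [r + 1]. *)
  move=> e0; have r1 : 0 < r + 1 by rewrite ltr_wpDl.
  have [|n hn] := @complex_expr_lt _ c (e / (r + 1)) c0 c1.
    exact: divr_gt0.
  exists n; apply: (@le_lt_trans _ _ (c ^+ n * (r + 1))).
    by rewrite ler_wpM2l ?exprn_ge0// lerDl.
  by rewrite -ltr_pdivlMr.
have /cauchy_cvgP/cvg_ex[l ul] : cauchy (u @ \oo)%classic.
  apply/cauchyP => e e0; have [n hn] := small e e0.
  exists (u n); exists n => // m /= nm.
  rewrite -ball_normE /= distrC -(subnKC nm); exact: le_lt_trans (uc _ _) hn.
have near_l e : 0 < e -> exists n, `|l - u n| <= e /\ `|l - u n.+1| <= e.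
  move=> e0; move/cvgrPdist_le: ul => /(_ e e0)[n _ hn].
  by exists n; split; apply: hn => /=.
have lr : `|l| <= r.
  apply/ler_addgt0Pr => e /near_l[n [ln _]].
  by rewrite -(subrK (u n) l) (le_trans (ler_normD _ _))// addrC lerD.
exists l => //; apply/eqP; rewrite -subr_eq0 -normr_le0.
apply/ler_addgt0Pr => e e0; rewrite add0r.
have [|n [ln ln1]] := near_l (e / 2); first by rewrite divr_gt0.
rewrite (splitr e) -(subrKA (u n.+1)) (le_trans (ler_normD _ _))// lerD//.
  apply: le_trans (Fc _ _ lr (ur n)) _; apply: le_trans ln.
  by rewrite ler_piMl// ltW.
by rewrite distrC.
Qed.

Section Cstar.
Variables (R : realType) (A : unitalCstarAlgType R).
Implicit Types x y h t : A.

Lemma starB x y : star (x - y) = star x - star y.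
Proof. by rewrite -[- y]scaleN1r starD starZ rmorphN rmorph1 scaleN1r. Qed.

Lemma star1 : star (1 : A) = 1.
Proof. by rewrite -[LHS]mul1r -[X in X * _]starK -starM mul1r starK. Qed.

(** The C*-identity makes the norm of 1 idempotent; it is 0 in the zero algebra. *)
Lemma cstar_norm1_le : `|1 : A| <= 1.
Proof.
have := cstar_normE (1 : A); rewrite star1 mul1r expr2.
have [->//|n0] := eqVneq `|1 : A| 0.
by rewrite -[X in X = _]mulr1 => /(mulfI n0) <-.
Qed.

Lemma norm_star x : `|star x| = `|x|.
Proof.
have le_star y : `|y| <= `|star y|.
  have [y0|n0] := eqVneq `|y| 0; first by rewrite y0.
  rewrite -(ler_pM2r (_ : 0 < `|y|)) ?lt_def ?n0 ?normr_ge0//.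
  by rewrite -expr2 -cstar_normE cstar_normrM.
by apply/eqP; rewrite eq_le -{2}(starK x) !le_star.
Qed.

Lemma norm_commuting_selfadjoint_le1 x y :
  star x = x -> star y = y -> GRing.comm x y -> x ^+ 2 + y ^+ 2 = 1 ->
  `|x| <= 1.
Proof.
move=> sx sy xy xy1; pose u := x + 'i *: y.
have su : star u = x - 'i *: y.
  by rewrite starD starZ sx sy conjCi scaleNr.
have u1 : `|u| <= 1.
  (* Commutation cancels the cross terms ['i *: (x * y)] and ['i *: (y * x)]. *)
  have uu : star u * u = 1.
    rewrite su mulrDl !mulrDr !mulNr -!cstar_scalerAl -!cstar_scalerAr.
    rewrite scalerA -(expr2 'i) sqrCi scaleN1r opprK xy.
    by rewrite addrA addrK -!expr2.
  rewrite -(ler_pXn2r (_ : 0 < 2)%N) ?nnegrE// expr1n -cstar_normE uu.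
  exact: cstar_norm1_le.
have xE : x *+ 2 = u + star u by rewrite su addrACA subrr addr0.
rewrite -(ler_pMn2r (_ : 0 < 2)%N)// -normrMn xE.
by rewrite (le_trans (ler_normD _ _))// norm_star mulr2n lerD.
Qed.

Lemma sqrB_noncomm x y : x ^+ 2 - y ^+ 2 = x * (x - y) + (x - y) * y.
Proof. by rewrite mulrBr mulrBl addrA subrK. Qed.

Lemma norm_half x : `|2^-1 *: x| = 2^-1 * `|x|.
Proof. by rewrite normrZ ger0_norm. Qed.

(** A fixed point [t] of [F] satisfies [t *+ 2 = h ^+ 2 + t ^+ 2], which rearranges to
    [(1 - t) ^+ 2 = 1 - h ^+ 2]. *)
Lemma selfadjoint_sqrt_compl h : star h = h -> `|h| < 1 ->
  exists k, [/\ star k = k, GRing.comm h k & h ^+ 2 + k ^+ 2 = 1].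
Proof.
move=> sh h1; pose F t := 2^-1 *: (h ^+ 2 + t ^+ 2).
have nX t : `|t ^+ 2| <= `|t| ^+ 2 by rewrite !expr2 cstar_normrM.
have half (a b : R[i]) : a <= b *+ 2 -> 2^-1 * a <= b.
  by move=> ab; rewrite ler_pdivrMl// mulr_natl.
have Fc x y : `|x| <= `|h| -> `|y| <= `|h| -> `|F x - F y| <= `|h| * `|x - y|.
  move=> xh yh; rewrite -scalerBr norm_half; apply: half.
  rewrite opprD addrACA subrr add0r sqrB_noncomm (le_trans (ler_normD _ _))//.
  rewrite mulr2n lerD// (le_trans (cstar_normrM _ _))//.
    by rewrite ler_wpM2r.
  by rewrite mulrC ler_wpM2r.
have [|t th Ft] :=
  @ball_fixed_point R A F `|h| `|h| (normr_ge0 h) (normr_ge0 h) h1 _ Fc.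
  move=> x xh; rewrite norm_half; apply: half.
  have hh : `|h| ^+ 2 <= `|h| by rewrite expr2 ler_piMl// ltW.
  rewrite (le_trans (ler_normD _ _))// mulr2n lerD// (le_trans (nX _))//.
  by rewrite (le_trans _ hh)// lerXn2r// nnegrE.
have lt0 x : `|x| <= `|h| * `|x| -> x = 0.
  move=> hx; apply/eqP; apply: contraTT h1; rewrite -normr_gt0 => x0.
  move: hx; rewrite -{1}[`|x|]mul1r ler_pM2r//.
  by move=> h1; rewrite le_gtF.
(* As [h] is self-adjoint, [star t] is also a fixed point in the ball; contraction makes the two
   equal. *)
have st : star t = t.
  apply/subr0_eq/lt0.
  have Fst : F (star t) = star t.
    by rewrite -[in RHS]Ft /F starZ starD !expr2 !starM sh fmorphV rmorph_nat.
  by have := Fc (star t) t; rewrite Fst Ft norm_star; exact.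
have tE : t *+ 2 = h ^+ 2 + t ^+ 2.
  by rewrite -[in LHS]Ft /F -scaler_nat scalerA divff ?scale1r ?pnatr_eq0.
(* Taking the commutator of [h] with the equation for [t] gives [d *+ 2 = d * t + t * d], so the
   norm of [d] is at most [|h|] times itself. *)
have ht : GRing.comm h t.
  apply/subr0_eq/lt0; set d := h * t - t * h.
  have dE : d *+ 2 = d * t + t * d.
    have -> : d *+ 2 = h * (t *+ 2) - (t *+ 2) * h.
      by rewrite mulrnBl mulrnAr mulrnAl.
    rewrite tE mulrDr mulrDl -exprS -exprSr opprD addrACA subrr add0r.
    by rewrite mulrBl mulrBr !expr2 !mulrA subrKA.
  rewrite -(ler_pMn2r (_ : 0 < 2)%N)// -normrMn dE.
  rewrite (le_trans (ler_normD _ _))// mulr2n.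
  rewrite lerD// (le_trans (cstar_normrM _ _))//.
    by rewrite mulrC ler_wpM2r.
  by rewrite ler_wpM2r.
exists (1 - t); split.
- by rewrite starB star1 st.
- exact: (commrB (commr1 _)).
- by rewrite -[1 - t]opprB sqrrN sqrrB1 tE [h ^+ 2 + t ^+ 2]addrC opprD !addNKr.
Qed.

End Cstar.

Section Contractive.
Variables (R : realType) (A B : unitalCstarAlgType R).
Variable phi : {rmorphism A -> B}.
Hypothesis phi_star : forall a : A, phi (star a) = star (phi a).

Lemma star_rmorphism_norm_le_nat (h : A) (n : nat) :
  star h = h -> `|h| < n%:R -> `|phi h| <= n%:R.
Proof.
move=> sh hn; have n0 : 0 < n%:R :> R[i] by exact: le_lt_trans hn.
pose g := n%:R^-1 *: h.
have sg : star g = g by rewrite starZ sh fmorphV rmorph_nat.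
have g1 : `|g| < 1.
  by rewrite normrZ ger0_norm ?invr_ge0 ?ltW// ltr_pdivrMl// mulr1.
have [k [sk gk gk1]] := selfadjoint_sqrt_compl _ _ _ sg g1.
(* An integer multiple passes through [phi] by additivity alone. *)
have -> : h = g *+ n.
  by rewrite /g -scaler_nat scalerA divff ?scale1r ?gt_eqF.
rewrite rmorphMn normrMn -[leLHS]mulr_natr ler_piMl ?(ltW n0)//.
apply: (@norm_commuting_selfadjoint_le1 _ _ _ (phi k)).
- by rewrite -phi_star sg.
- by rewrite -phi_star sk.
- by rewrite /GRing.comm -!rmorphM gk.
- by rewrite -!rmorphXn -rmorphD gk1 rmorph1.
Qed.

Lemma star_rmorphism_norm_le_selfadjoint (h : A) :
  star h = h -> `|phi h| <= `|h|.
Proof.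
move=> sh; apply/ler_addgt0Pr => e e0.
(* Rounding the norm of [h *+ m.+1] up to an integer costs at most 1; after division by [m.+1],
   which exceeds [e^-1], the error is below [e]. *)
have [|m /andP[_ em]] := @complex_truncn R e^-1; first by rewrite invr_ge0 ltW.
have smh : star (h *+ m.+1) = h *+ m.+1.
  by rewrite -scaler_nat starZ sh conjC_nat.
have [|n /andP[nh hn]] := @complex_truncn R `|h *+ m.+1| => //.
have := star_rmorphism_norm_le_nat _ _ smh hn.
rewrite rmorphMn normrMn => le1.
rewrite -(ler_pMn2r (_ : 0 < m.+1)%N)// (le_trans le1)// mulrnDl -normrMn.
rewrite -natr1 lerD// -mulr_natl -ler_pdivrMr// mul1r; exact: ltW.
Qed.

Lemma star_rmorphism_norm_le (a : A) : `|phi a| <= `|a|.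
Proof.
rewrite -(ler_pXn2r (_ : 0 < 2)%N) ?nnegrE// -!cstar_normE -phi_star -rmorphM.
by apply: star_rmorphism_norm_le_selfadjoint; rewrite starM starK.
Qed.

End Contractive.

Theorem theorem3p6 (R : realType) (A B : unitalCstarAlgType R)
    (phi : {rmorphism A -> B})
    (phi_star : forall a : A, phi (star a) = star (phi a)) :
  (forall a : A, `|phi a| <= `|a|) /\ continuous phi.
Proof.
have phi_le := star_rmorphism_norm_le _ _ _ _ phi_star; split=> // x.
apply/cvgrPdist_lt => e e0.
have /cvgrPdist_lt/(_ e e0) : (y @[y --> x] --> x)%classic by exact: cvg_id.
apply: filterS => y; apply: le_lt_trans.
by rewrite -rmorphB phi_le.
Qed.
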